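(* For every finite $m\geq 1$ and every finite tuple $\bar a$ from $\mathcal{A}_{m+1}=[m+1:\omega]$, $\operatorname{SR}(\mathcal{A}_{m+1},\bar a)=2m+1$.
   Context: Trees. A tree is a structure $(T,\prec)$ in the language $\{\prec\}$ where $\prec$ is a strict partial order, the predecessors of each element form a finite linearly ordered set, and there is a $\prec$-least element, the root; trees are countable and have no infinite paths. The level of $x$ is its number of predecessors. Rank: terminal nodes have rank $0$, $\mathrm{rk}(x)=\sup\{\mathrm{rk}(y)+1: y$ an immediate successor of $x\}$, and the rank of $T$ is that of its root. For finite $n\geq1$ and $N\in\omega\cup\{\omega\}$ the tree type $[n:N]$ is defined inductively: $[1:N]$ is the tree of rank $\leq1$ whose root has exactly $N$ children; $[n:N]$ ($n\geq 2$) is the tree of rank $n$ in which exactly $N$ level-one nodes are roots of subtrees of type $[n-1:\omega]$, for every $k\in\omega$ (including $k=0$) infinitely many level-one nodes are roots of subtrees of type $[n-1:k]$, and there are no other level-one nodes. (''$\omega$ many'' and ''infinitely many'' mean countably infinitely many.) $(\mathcal{A}_{m+1},\bar a)$ is the expansion of $\mathcal{A}_{m+1}$ by constants naming the entries of $\bar a$ (repeats allowed). Infinitary formulas: $\Sigma^{\mathrm{in}}_0=\Pi^{\mathrm{in}}_0$ are the finitary quantifier-free formulas; for $\alpha\geq1$, a $\Sigma^{\mathrm{in}}_\alpha$ formula is a countable disjunction of formulas $\exists\bar y\,\psi$ with $\psi\in\Pi^{\mathrm{in}}_\beta$, $\beta<\alpha$, and dually $\Pi^{\mathrm{in}}_\alpha$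 (countable conjunctions of $\forall\bar y\,\psi$, $\psi\in\Sigma^{\mathrm{in}}_\beta$, $\beta<\alpha$). $\operatorname{SR}(\mathcal{M})$ is the least $\alpha$ such that every automorphism orbit of every finite tuple of $\mathcal{M}$ is definable by a $\Sigma^{\mathrm{in}}_\alpha$ formula in the language of $\mathcal{M}$ without further parameters. *)

(* Defs.v *)
From mathcomp Require Import all_boot.
From mathcomp Require Import boolp classical_sets functions cardinality.

Set Implicit Arguments.
Unset Strict Implicit.
Unset Printing Implicit Defensive.

Local Open Scope classical_set_scope.
Local Open Scope card_scope.

(* An element of \omega \cup {\omega}: [None] stands for \omega. *)
Definition nat_or_omega := option nat.
Definition omega : nat_or_omega := None.

Definition has_card (U : Type) (A : set U) (N : nat_or_omega) : Prop :=
  if N is Some k then A #= `I_k else A #= [set: nat].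

Section Trees.
Variables (T : Type) (prec : T -> T -> Prop).

Definition is_root (r : T) : Prop := forall x, x = r \/ prec r x.

Record is_tree : Prop := IsTree {
  tree_irr : forall x, ~ prec x x;
  tree_trans : forall x y z, prec x y -> prec y z -> prec x z;
  tree_finite_preds : forall x, finite_set [set y | prec y x];
  tree_linear_preds : forall x y z, prec y x -> prec z x ->
    prec y z \/ y = z \/ prec z y;
  tree_root : exists r, is_root r;
  tree_countable : countable [set: T];
  tree_no_infinite_path :
    ~ exists p : nat -> T, forall i, prec (p i) (p i.+1)
}.

Definition immediate_succ (x y : T) : Prop :=
  prec x y /\ ~ exists z, prec x z /\ prec z y.

(* [has_rank x r]: the (in general ordinal-valued) rank of x is the finite
   ordinal r, i.e. r is the least upper bound of the rk y + 1, for y an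
   immediate successor of x. *)
Inductive has_rank : T -> nat -> Prop :=
| HasRank x r (rk : T -> nat) :
    (forall y, immediate_succ x y -> has_rank y (rk y)) ->
    (forall y, immediate_succ x y -> (rk y).+1 <= r) ->
    (forall s, (forall y, immediate_succ x y -> (rk y).+1 <= s) -> r <= s) ->
    has_rank x r.

(* [subtree_type n N x]: the subtree {y | y = x or x \prec y} rooted at x is of
   type [n:N].  Its level-one nodes are the immediate successors of x, and the
   rank of any of its nodes is the same in the subtree as in T.  The type [0:N]
   does not exist. *)
Fixpoint subtree_type (n : nat) (N : nat_or_omega) (x : T) : Prop :=
  match n with
  | 0 => False
  | 1 => (exists2 r, r <= 1 & has_rank x r)
         /\ has_card [set y | immediate_succ x y] N
  | n'.+1 =>
      [/\ has_rank x n,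
          has_card [set y | immediate_succ x y /\ subtree_type n' omega y] N,
          forall k : nat, has_card
            [set y | immediate_succ x y /\ subtree_type n' (Some k) y] omega
        & forall y, immediate_succ x y ->
            subtree_type n' omega y \/ exists k, subtree_type n' (Some k) y]
  end.

Definition tree_of_type (n : nat) (N : nat_or_omega) : Prop :=
  is_tree /\ exists2 r, is_root r & subtree_type n N r.

End Trees.

(* Formulas over the language {\prec, c_0, ..., c_(k-1)}, with free variables
   x_0, ..., x_(n-1). *)
Inductive term (k n : nat) : Type :=
| Var of 'I_n
| Const of 'I_k.

Inductive qf_formula (k n : nat) : Type :=
| QTrue
| QFalse
| QEq of term k n & term k n
| QPrec of term k n & term k n
| QNot of qf_formula k n
| QAnd of qf_formula k n & qf_formula k n
| QOr of qf_formula k n & qf_formula k n.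

(* [Sigma_in k a n] and [Pi_in k a n] are the infinitary formulas of the finite
   level a.  In [Sigma_or] the i-th disjunct quantifies existentially a block of
   [l i] new variables, which become the variables x_n, ..., x_(n + l i - 1) of
   [psi i]. *)
Inductive Sigma_in (k : nat) : nat -> nat -> Type :=
| Sigma_qf n : qf_formula k n -> Sigma_in k 0 n
| Sigma_or a n (J : countType) (b l : J -> nat) :
    0 < a -> (forall i, b i < a) ->
    (forall i, Pi_in k (b i) (n + l i)) -> Sigma_in k a n
with Pi_in (k : nat) : nat -> nat -> Type :=
| Pi_qf n : qf_formula k n -> Pi_in k 0 n
| Pi_and a n (J : countType) (b l : J -> nat) :
    0 < a -> (forall i, b i < a) ->
    (forall i, Sigma_in k (b i) (n + l i)) -> Pi_in k a n.

Section Structures.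
Variables (T : Type) (prec : T -> T -> Prop) (k : nat) (c : k.-tuple T).

Definition term_val n (x : n.-tuple T) (t : term k n) : T :=
  match t with
  | Var i => tnth x i
  | Const j => tnth c j
  end.

Fixpoint qf_sat n (x : n.-tuple T) (q : qf_formula k n) : Prop :=
  match q with
  | QTrue => True
  | QFalse => False
  | QEq s t => term_val x s = term_val x t
  | QPrec s t => prec (term_val x s) (term_val x t)
  | QNot q1 => ~ qf_sat x q1
  | QAnd q1 q2 => qf_sat x q1 /\ qf_sat x q2
  | QOr q1 q2 => qf_sat x q1 \/ qf_sat x q2
  end.

Fixpoint Sigma_sat a n (phi : Sigma_in k a n) : n.-tuple T -> Prop :=
  match phi with
  | Sigma_qf n q => fun x => qf_sat x q
  | @Sigma_or _ a n J b l _ _ psi => fun x =>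
      exists (i : J) (y : (l i).-tuple T), Pi_sat (psi i) (cat_tuple x y)
  end
with Pi_sat a n (phi : Pi_in k a n) : n.-tuple T -> Prop :=
  match phi with
  | Pi_qf n q => fun x => qf_sat x q
  | @Pi_and _ a n J b l _ _ psi => fun x =>
      forall (i : J) (y : (l i).-tuple T), Sigma_sat (psi i) (cat_tuple x y)
  end.

Definition automorphism (f : T -> T) : Prop :=
  [/\ bijective f,
      forall x y, prec x y <-> prec (f x) (f y)
    & map_tuple f c = c].

Definition orbit_of n (x : n.-tuple T) : set (n.-tuple T) :=
  [set y | exists2 f, automorphism f & y = map_tuple f x].

Definition orbits_Sigma_definable (a : nat) : Prop :=
  forall n (x : n.-tuple T), exists phi : Sigma_in k a n,
    [set y | Sigma_sat phi y] = orbit_of x.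

(* SR(T, \prec, c) = a.  Every ordinal below the finite ordinal a is finite, so
   the minimality of a among all ordinals involves finite levels only. *)
Definition SR_is (a : nat) : Prop :=
  orbits_Sigma_definable a /\ forall b, b < a -> ~ orbits_Sigma_definable b.

End Structures.

(* Main.v *)
Require Import Defs.
From mathcomp Require Import all_boot.
From mathcomp Require Import boolp classical_sets functions cardinality.
From mathcomp Require Import zify.

Set Implicit Arguments.
Unset Strict Implicit.
Unset Printing Implicit Defensive.

(** A node of the tree carries two data: the [n] and the [N] of the type [n:N]
of the subtree above it, called here its index [rk x] and its label [lab x].
(The children of the nodes of type [1:N] get index 0 and, by convention, label
omega.)  The index is read off the level, so only labels matter.  The label of
a node of index [n >= 1] counts its omega-labelled children, and that count
costs two quantifier alternations per index: having at least [j] such children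
is Sigma_(2n-1), hence having label omega is Pi_(2n), and so is having label
[j].

Upper bound.  The tree is homogeneous: a finite partial map that is defined on
a set closed under parents and respects the root, the parent relation and the
labels extends to an automorphism ([lab_iso_automorphism]).  So the orbit of a
tuple over the constants is defined by saying that there are further nodes
which, with the tuple and the constants, form a copy of its closure under
parents.  All nodes but the root have index at most [m], so the part behind the
existential quantifier is Pi_(2m) ([Pi_def_labelled], [orbits_Sigma]).

Lower bound.  Let [x] be a child of the root, labelled omega, with none of the
constants at or above it.  A Sigma_(2m) formula true of [x] has a finite
witness [w] for which a Pi_b formula, b < 2m, holds.  Replace [x] by a child [u]
of the root whose label is finite but larger than anything that [w] can use
up.  The pair of tuples so obtained satisfies the combinatorial relation
[close (2m-1)], and [close a] is designed to be a winning position, for the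
player who answers, in the game of length [a] that compares Pi_a formulas
([back_and_forth], [transfer]).  So the formula is true of [u] as well, but no
automorphism sends [x] to [u], their labels being different
([not_Sigma_definable]). *)

Local Open Scope classical_set_scope.
Local Open Scope card_scope.

(** * Counting in omega + 1 *)

(** The order [k <= N] of omega + 1, for [k] finite.  Labels are compared only
through the finite [k] below them. *)
Definition at_most (k : nat) (N : nat_or_omega) : bool :=
  if N is Some j then k <= j else true.

Definition at_least (T : eqType) (A : set T) (k : nat) : Prop :=
  exists s : seq T, [/\ uniq s, size s = k & forall x, x \in s -> A x].

Lemma at_most_inj N N' : (forall k, at_most k N <-> at_most k N') -> N = N'.
Proof.
case: N N' => [j|] [j'|] //= H.
- have := H j; have := H j'; rewrite !leqnn => -[_ a] [b _].
  by congr Some; apply/eqP; rewrite eqn_leq a // b.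
- by have := H j.+1; rewrite ltnn => -[_ /(_ isT)].
- by have := H j'.+1; rewrite ltnn => -[/(_ isT)].
Qed.

Lemma at_least_card (T : eqType) (A : set T) N k :
  has_card A N -> (at_least A k <-> at_most k N).
Proof.
move=> AN.
have [f f_inj fP] : exists2 f : T -> nat, {in A &, injective f} &
    (forall x, A x -> at_most (f x).+1 N) /\
    forall i, at_most i.+1 N -> exists2 x, A x & f x = i.
  case: N AN => [j|] /card_set_bijP[f [f1 f2 f3]]; exists f => //.
  by split=> // i _; have [x ? <-] := f3 i Logic.I; exists x.
case: fP => fN fsurj; split.
- case=> s [us <- sA]; case: N AN fN fsurj => //= j _ fN _.
  rewrite -(size_map f) -[leqRHS](size_iota 0); apply: uniq_leq_size.
    by rewrite map_inj_in_uniq // => x y /sA/mem_set ? /sA/mem_set ?;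
      apply: f_inj.
  by move=> _ /mapP[x /sA/fN ? ->]; rewrite mem_iota.
- move=> kN.
  have /choice[g gP] : forall i : 'I_k, exists x, A x /\ f x = i.
    move=> i; have [|x ? ?] := fsurj i; last by exists x.
    by case: N kN {AN fN fsurj} => //= j; apply: leq_trans.
  exists [seq g i | i <- enum 'I_k]; split.
  + rewrite map_inj_uniq ?enum_uniq // => i j gij; apply: val_inj.
    by rewrite /= -(gP i).2 -(gP j).2 gij.
  + by rewrite size_map size_enum_ord.
  + by move=> _ /mapP[i _ ->]; case: (gP i).
Qed.

Lemma has_card_inj (T : eqType) (A : set T) N N' :
  has_card A N -> has_card A N' -> N = N'.
Proof.
move=> AN AN'; apply: at_most_inj => k.
by split=> [/(at_least_card k AN)/(at_least_card k AN')|
            /(at_least_card k AN')/(at_least_card k AN)].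
Qed.

(** Where new nodes come from: a set too large for a finite list has an element
outside it. *)
Lemma at_least_avoid (T : eqType) (A : set T) (k : nat) (s : seq T) :
  at_least A k -> size s < k -> exists2 x, x \notin s & A x.
Proof.
case=> t [ut <- tA] st; apply: contrapT => no.
have: size t <= size s.
  apply: uniq_leq_size => // x xt; apply/negPn/negP => xs; apply: no.
  by exists x => //; apply: tA.
by rewrite leqNgt st.
Qed.

(** * Trees with finite predecessor sets *)

(** Applied to the order and to its converse, it gives a node its parent and
gives a pair [x \prec y] the child of [x] below [y]. *)
Lemma finite_maximal (T : eqType) (R : T -> T -> Prop) (s : seq T) x :
  (forall x, ~ R x x) -> (forall x y z, R x y -> R y z -> R x z) -> x \in s ->
  exists z, [/\ z \in s, x = z \/ R x z & forall w, w \in s -> ~ R z w].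
Proof.
move=> irr trans; elim: s x => // a s IH x.
have lift b : b \in s ->
    exists z, [/\ z \in a :: s, b = z \/ R b z & forall w,
      w \in a :: s -> ~ R z w].
  move=> /IH[z [zs bz zmax]].
  have [za|nza] := pselect (R z a); last first.
    exists z; split; rewrite ?inE ?zs ?orbT // => w.
    by rewrite inE => /predU1P[->|/zmax].
  exists a; split; rewrite ?inE ?eqxx //.
    by right; case: bz => [->|/trans]; [|apply].
  move=> w; rewrite inE => /predU1P[->|ws aw]; first exact: irr.
  exact: zmax ws (trans _ _ _ za aw).
rewrite inE => /predU1P[->|/lift//].
have [[w ws aw]|no] := pselect (exists2 w, w \in s & R a w).
  have [z [zs wz zmax]] := lift w ws; exists z; split=> //.
  by right; case: wz => [<-|/(trans _ _ _ aw)].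
exists a; split; rewrite ?inE ?eqxx //; first by left.
move=> w; rewrite inE => /predU1P[->|ws aw]; first exact: irr.
by apply: no; exists w.
Qed.

Lemma finite_setE (T : eqType) (A : set T) :
  finite_set A -> exists s : seq T, forall x, A x <-> x \in s.
Proof. by move=> /finite_seqP[s ->]; exists s. Qed.

Section Tree.
Variables (T : eqType) (prec : T -> T -> Prop).
Hypothesis tree : is_tree prec.

Local Notation child := (immediate_succ prec).

Lemma parent_between x y :
  prec x y -> exists2 z, child z y & x = z \/ prec x z.
Proof.
move=> xy.
have /finite_setE[s sP] := tree_finite_preds tree y.
have [z [/sP zy xz zmax]] :=
  finite_maximal (tree_irr tree) (tree_trans tree) ((sP x).1 xy).
exists z => //; split=> // -[w [zw /sP wy]]; exact: zmax zw.
Qed.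

Lemma child_between x y :
  prec x y -> exists2 z, child x z & z = y \/ prec z y.
Proof.
move=> xy; have /finite_setE[s sP] := tree_finite_preds tree y.
have pP z : prec x z /\ (z = y \/ prec z y) <->
    z \in [seq z <- y :: s | `[< prec x z >]].
  rewrite mem_filter inE; split.
    by move=> [/asboolP-> [->|/sP->]]; rewrite ?eqxx ?orbT.
  by move=> /andP[/asboolP ? /predU1P[?|/sP ?]]; split=> //; [left|right].
have [z [/pP[xz zy] _ zmin]] := finite_maximal (R := fun a b => prec b a)
  (tree_irr tree) (fun a b c ba cb => tree_trans tree cb ba)
  ((pP y).1 (conj xy (or_introl erefl))).
exists z => //; split=> // -[w [xw wz]]; apply: zmin (wz); apply/pP; split=> //.
by right; case: zy => [<-//|]; apply: tree_trans wz.
Qed.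

Lemma parent_unique x x' y : child x y -> child x' y -> x = x'.
Proof.
move=> [xy nx] [x'y nx'].
have [xx'|[//|xx']] := tree_linear_preds tree xy x'y.
  by case: nx; exists x'.
by case: nx'; exists x.
Qed.

Lemma prec_child x y z : child y z -> prec x z <-> x = y \/ prec x y.
Proof.
move=> yz; split=> [/parent_between[w wz]|].
  by rewrite (parent_unique wz yz).
by case: yz => yz _ [->//|xy]; apply: tree_trans xy yz.
Qed.

(** The order is well-founded because a node has finitely many predecessors. *)
Lemma tree_ind (P : T -> Prop) :
  (forall y, (forall x, prec x y -> P x) -> P y) -> forall y, P y.
Proof.
move=> step y; have /finite_setE[s sP] := tree_finite_preds tree y.
have: forall x, prec x y -> x \in undup s by move=> x /sP; rewrite mem_undup.
move: (undup s) (undup_uniq s) => {sP}{}s; have [n] := ubnP (size s).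
elim: n y s => // n IH y s sn us ys.
apply: step => x xy; have xs := ys _ xy; apply: (IH x (rem x s)).
- by rewrite size_rem //; case: s xs sn {us ys}.
- exact: rem_uniq.
move=> z zx; rewrite mem_rem_uniq // inE ys ?andbT; last first.
  exact: tree_trans tree _ _ _ zx xy.
by apply/eqP=> zE; case: (tree_irr tree (x := x)); rewrite -{1}zE.
Qed.

End Tree.

(** * Closure properties of definability *)

Section Definability.
Variables (T : Type) (prec : T -> T -> Prop) (k : nat) (c : k.-tuple T).

(** Definability is treated semantically, for predicates on tuples.  Unary
predicates are always taken at an arbitrary coordinate of a tuple of arbitrary
length; this takes the place of substitution in formulas. *)
Definition qf_def n (A : n.-tuple T -> Prop) : Prop :=
  exists q : qf_formula k n, forall x, qf_sat prec c x q <-> A x.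

Definition Sigma_def a n (A : n.-tuple T -> Prop) : Prop :=
  exists phi : Sigma_in k a n, forall x, Sigma_sat prec c phi x <-> A x.

Definition Pi_def a n (A : n.-tuple T -> Prop) : Prop :=
  exists phi : Pi_in k a n, forall x, Pi_sat prec c phi x <-> A x.

Lemma Sigma_def_ext a n (A B : n.-tuple T -> Prop) :
  (forall x, A x <-> B x) -> Sigma_def a A -> Sigma_def a B.
Proof. by move=> AB [phi phiA]; exists phi => x; rewrite phiA. Qed.

Lemma Pi_def_ext a n (A B : n.-tuple T -> Prop) :
  (forall x, A x <-> B x) -> Pi_def a A -> Pi_def a B.
Proof. by move=> AB [phi phiA]; exists phi => x; rewrite phiA. Qed.

Lemma Sigma_def_exists a n (J : countType) (b l : J -> nat)
    (A : forall i, (n + l i).-tuple T -> Prop) :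
  0 < a -> (forall i, b i < a) -> (forall i, Pi_def (b i) (A i)) ->
  Sigma_def a (fun x => exists i y, A i (cat_tuple x y)).
Proof.
move=> a0 ba PA; exists (Sigma_or a0 ba (fun i => sval (cid (PA i)))) => x /=.
by split=> -[i [y /(svalP (cid (PA i)))]]; exists i, y.
Qed.

Lemma Pi_def_forall a n (J : countType) (b l : J -> nat)
    (A : forall i, (n + l i).-tuple T -> Prop) :
  0 < a -> (forall i, b i < a) -> (forall i, Sigma_def (b i) (A i)) ->
  Pi_def a (fun x => forall i y, A i (cat_tuple x y)).
Proof.
move=> a0 ba SA; exists (Pi_and a0 ba (fun i => sval (cid (SA i)))) => x /=.
by split=> H i y; apply/(svalP (cid (SA i))).
Qed.

Lemma Sigma_Pi_def_not b :
  (forall n (phi : Sigma_in k b n), Pi_def b (fun x => ~ Sigma_sat prec c phi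
    x)) /\
  (forall n (phi : Pi_in k b n), Sigma_def b (fun x => ~ Pi_sat prec c phi x)).
Proof.
elim/ltn_ind: b => b IH; split=> n phi.
  case: phi IH => [n' q _|b' n' J e l b0 eb psi IH].
    by exists (Pi_qf (QNot q)) => x.
  apply: (Pi_def_ext (A := fun x => forall i y,
    ~ Pi_sat prec c (psi i) (cat_tuple x y))).
    move=> x /=; split=> [H [i [y]]|H i y]; first exact: H.
    by move=> ps; apply: H; exists i, y.
  by apply: (Pi_def_forall (A := fun i z => ~ Pi_sat prec c (psi i) z) b0 eb)
    => i;
    apply: (IH _ (eb i)).2.
case: phi IH => [n' q _|b' n' J e l b0 eb psi IH].
  by exists (Sigma_qf (QNot q)) => x.
apply: (Sigma_def_ext (A := fun x => exists i y,
  ~ Sigma_sat prec c (psi i) (cat_tuple x y))).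
  move=> x /=; split=> [[i [y ns]] H|]; first exact: ns.
  move=> H; apply: contrapT => no; apply: H => i y; apply: contrapT => ns.
  by apply: no; exists i, y.
by apply: (Sigma_def_exists (A := fun i z => ~ Sigma_sat prec c (psi i) z) b0
  eb) => i;
  apply: (IH _ (eb i)).1.
Qed.

Lemma Sigma_def_not a n (A : n.-tuple T -> Prop) :
  Sigma_def a A -> Pi_def a (fun x => ~ A x).
Proof.
move=> [phi phiA]; apply: Pi_def_ext ((Sigma_Pi_def_not a).1 _ phi) => x.
by rewrite phiA.
Qed.

Lemma Pi_def_qf n (A : n.-tuple T -> Prop) : Pi_def 0 A <-> qf_def A.
Proof.
split=> [[phi]|[q qA]]; last by exists (Pi_qf q).
suff H a (psi : Pi_in k a n) : a = 0 ->
    (forall x, Pi_sat prec c psi x <-> A x) -> qf_def A by apply: (H _ phi).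
case: psi A {phi} => [n' q A _ qA|a' n' J b l a0 ba psi A aE];
  first by exists q.
by exfalso; move: (a0); rewrite aE.
Qed.

(** Stated as an informative sum, so that a family of formulas can be opened
by a function of its index. *)
Lemma Pi_def_block a n (A : n.-tuple T -> Prop) : 0 < a -> Pi_def a A ->
  {J : countType & {bl : (J -> nat) * (J -> nat) &
  {B : forall i, (n + bl.2 i).-tuple T -> Prop |
    (forall i, bl.1 i < a /\ Sigma_def (bl.1 i) (B i)) /\
    forall x, A x <-> forall i y, B i (cat_tuple x y)}}}.
Proof.
move=> a0 /cid[phi]; case: phi A a0 => [n' q A //|a' n' J b l a0 ba psi A _
  psiA].
exists J, (b, l), (fun i => Sigma_sat prec c (psi i)); split=> [i|x].
  by split; [exact: ba|exists (psi i)].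
by rewrite -psiA.
Qed.

(** A countable conjunction of Pi_a formulas, [0 < a], is the conjunction of
all their conjuncts, indexed by the disjoint union of the index types. *)
Lemma Pi_def_all_pos a n (J : countType) (A : J -> n.-tuple T -> Prop) :
  0 < a -> (forall j, Pi_def a (A j)) -> Pi_def a (fun x => forall j, A j x).
Proof.
move=> a0 PA; pose blk j := Pi_def_block a0 (PA j).
pose K j := projT1 (blk j); pose bl j := projT1 (projT2 (blk j)).
pose B j := sval (projT2 (projT2 (blk j))).
have BP j : (forall i, (bl j).1 i < a /\ Sigma_def ((bl j).1 i) (@B j i)) /\
    forall x, A j x <-> forall i y, B j i (cat_tuple x y).
  exact: svalP (projT2 (projT2 (blk j))).
pose I : countType := {j : J & K j}.
apply: (Pi_def_ext (A := fun x => forall (i : I)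
    (y : ((bl (tag i)).2 (tagged i)).-tuple T), B _ _ (cat_tuple x y))).
  move=> x; split=> H j; first by apply/(BP j).2 => i y;
    apply: (H (existT _ j i)).
  by case: j => j i y; apply: ((BP j).2 x).1.
apply: (Pi_def_forall (J := I) (b := fun i => (bl (tag i)).1 (tagged i))
  (A := fun i => @B (tag i) (tagged i))) => // -[j i] /=.
  exact: ((BP j).1 i).1.
exact: ((BP j).1 i).2.
Qed.

Lemma qf_def_all n (J : finType) (A : J -> n.-tuple T -> Prop) :
  (forall j, qf_def (A j)) -> qf_def (fun x => forall j, A j x).
Proof.
move=> /choice[q qA]; exists (foldr (fun j => QAnd (q j)) (QTrue k n) (enum J))
  => x.
transitivity (forall j, j \in enum J -> A j x); last first.
  by split=> H j; [apply: H; rewrite mem_enum|].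
elim: (enum J) => [//|j s IH] /=; rewrite IH qA; split=> [[Aj H] i|H].
  by rewrite inE => /predU1P[->|/H].
by split=> [|i si]; apply: H; rewrite inE ?eqxx ?si ?orbT.
Qed.

Lemma Pi_def_all a n (J : finType) (A : J -> n.-tuple T -> Prop) :
  (forall j, Pi_def a (A j)) -> Pi_def a (fun x => forall j, A j x).
Proof.
case: a => [|a] PA; last exact: Pi_def_all_pos.
by apply/Pi_def_qf; apply: qf_def_all => j; apply/Pi_def_qf.
Qed.

Lemma Pi_def_and a n (A B : n.-tuple T -> Prop) :
  Pi_def a A -> Pi_def a B -> Pi_def a (fun x => A x /\ B x).
Proof.
move=> PA PB; have: forall b : bool, Pi_def a (if b then A else B) by case.
move=> /Pi_def_all; apply: Pi_def_ext => x.
by split=> [H|[Ax Bx] []//]; split; [have := H true|have := H false].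
Qed.

Definition widen_term n l (t : term k n) : term k (n + l) :=
  match t with Var i => Var k (lshift l i) | Const j => Const (n + l) j end.

Fixpoint widen_qf n l (q : qf_formula k n) : qf_formula k (n + l) :=
  match q with
  | QTrue => QTrue k (n + l)
  | QFalse => QFalse k (n + l)
  | QEq s t => QEq (widen_term l s) (widen_term l t)
  | QPrec s t => QPrec (widen_term l s) (widen_term l t)
  | QNot q1 => QNot (widen_qf l q1)
  | QAnd q1 q2 => QAnd (widen_qf l q1) (widen_qf l q2)
  | QOr q1 q2 => QOr (widen_qf l q1) (widen_qf l q2)
  end.

Lemma widen_qfP n l (q : qf_formula k n) (x : n.-tuple T) (y : l.-tuple T) :
  qf_sat prec c (cat_tuple x y) (widen_qf l q) <-> qf_sat prec c x q.
Proof.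
have E t : term_val c (cat_tuple x y) (widen_term l t) = term_val c x t.
  by case: t => //= i; rewrite tnth_lshift.
by elim: q => [||t u|t u|q|q IHq q'|q IHq q'] /=; rewrite ?E; tauto.
Qed.

Lemma Pi_def_le a b n (A : n.-tuple T -> Prop) :
  a <= b -> Pi_def a A -> Pi_def b A.
Proof.
case: a => [|a] ab PA; last first.
  have [J [[e l] /= [B [eB BA]]]] := Pi_def_block (ltn0Sn a) PA.
  apply: (Pi_def_ext (fun x => iff_sym (BA x)));
    apply: (@Pi_def_forall _ _ J e l B).
  - exact: leq_trans ab.
  - by move=> i; apply: leq_trans ab; case: (eB i).
  - by move=> i; case: (eB i).
case: b ab => // b _; have /Pi_def_qf[q qA] := PA.
apply: (Pi_def_ext (A := fun x => forall (i : unit) (y : 0.-tuple T),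
    qf_sat prec c (cat_tuple x y) (widen_qf 0 q))).
  move=> x; split=> [H|/qA H i y]; last exact/widen_qfP.
  exact/qA/(widen_qfP q x [tuple])/(H tt).
apply: (@Pi_def_forall _ _ unit (fun=> 0) (fun=> 0)
  (fun _ z => qf_sat prec c z (widen_qf 0 q))) => // i.
by exists (Sigma_qf (widen_qf 0 q)).
Qed.

Lemma Pi_def_imply a n (P : Prop) (A : n.-tuple T -> Prop) :
  (P -> Pi_def a A) -> Pi_def a (fun x => P -> A x).
Proof.
move=> PA; have [p|np] := pselect P.
  by apply: Pi_def_ext (PA p) => x; split=> // H; apply: H.
apply: (@Pi_def_le 0) => //; apply/Pi_def_qf; exists (QTrue k n) => x /=.
by split.
Qed.

End Definability.

(** * Levels and labels *)

Section TypedTree.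
Variables (T : eqType) (prec : T -> T -> Prop) (m : nat) (r : T).
Hypothesis tree : is_tree prec.
Hypothesis root_r : is_root prec r.
Hypothesis type_r : subtree_type prec m.+1 omega r.

Local Notation child := (immediate_succ prec).

(** The derivation goes down from the root, so it pins down the [n] of the type
[n:N] of each node, which [subtree_type] alone does not define for the children
of the nodes of type [1:N]. *)
Inductive typed : nat -> nat_or_omega -> T -> Prop :=
| TypedRoot : typed m.+1 omega r
| TypedNode n N N' x y : typed n.+2 N x -> child x y ->
    subtree_type prec n.+1 N' y -> typed n.+1 N' y
| TypedLeaf N x y : typed 1 N x -> child x y -> typed 0 omega y.

Lemma typed_subtree n N x : typed n.+1 N x -> subtree_type prec n.+1 N x.
Proof. by move=> t; inversion t; subst. Qed.

Lemma child_root x : ~ child x r.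
Proof.
case=> xr _; case: (root_r x) => [xE|rx].
  by rewrite xE in xr; case: (tree_irr tree xr).
exact: (tree_irr tree (tree_trans tree xr rx)).
Qed.

Lemma typed_parent n N y : typed n N y ->
  (n = m.+1 /\ y = r) \/ exists x N', child x y /\ typed n.+1 N' x.
Proof.
case=> [|{}n N1 N' x {}y tx xy _|N' x {}y tx xy]; first by left.
- by right; exists x, N1.
- by right; exists x, N'.
Qed.

(** A node of type [1:N] has rank at most 1, so its children are terminal. *)
Lemma leaf_childless N x y z : typed 1 N x -> child x y -> ~ child y z.
Proof.
move=> /typed_subtree[[d d1 xd] _]; case: xd d1 => {}x {}d rk rkP rkd _ d1 xy
  yz.
have := rkP _ xy; have := rkd _ xy => yd; move: (leq_trans yd d1).
rewrite ltnS leqn0 => /eqP -> y0.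
inversion_clear y0 as [? ? rk' _ b _].
by have := b _ yz.
Qed.

Lemma typed_total x : exists p, typed p.1 p.2 x.
Proof.
elim/(tree_ind tree): x => y IH.
have [->|ry] := root_r y; first by exists (m.+1, omega); apply: TypedRoot.
have [x xy _] := parent_between tree ry.
have [[n N] /= tx] := IH _ xy.1.
case: n tx => [|[|n]] tx.
- case: (typed_parent tx) => [[//]|[w [N' [wx tw]]]].
  by case: (leaf_childless tw wx xy).
- by exists (0, omega); apply: TypedLeaf tx xy.
- have [_ _ _ /(_ _ xy)[ty|[k ty]]] := typed_subtree tx.
    by exists (n.+1, omega); apply: TypedNode tx xy ty.
  by exists (n.+1, Some k); apply: TypedNode tx xy ty.
Qed.

Lemma typed_rk_unique n N n' N' x : typed n N x -> typed n' N' x -> n = n'.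
Proof.
elim/(tree_ind tree): x n N n' N' => y IH n N n' N' /typed_parent t
  /typed_parent t'.
case: t t' => [[-> ->]|[x [N1 [xy tx]]]] [[-> yr]|[x' [N2 [xy' tx']]]] //.
- by case: (child_root xy').
- by rewrite yr in xy; case: (child_root xy).
- rewrite -(parent_unique tree xy xy') in tx'.
  by have [] := IH x xy.1 _ _ _ _ tx tx'.
Qed.

Lemma subtree_type_unique n N N' x :
  subtree_type prec n N x -> subtree_type prec n N' x -> N = N'.
Proof.
case: n => [|[|n]] //=.
  by move=> [_ c] [_ c']; apply: has_card_inj c c'.
by move=> [_ c _ _] [_ c' _ _]; apply: has_card_inj c c'.
Qed.

Lemma typed_unique n N n' N' x :
  typed n N x -> typed n' N' x -> n = n' /\ N = N'.
Proof.
move=> t t'; have nn := typed_rk_unique t t'; split=> //; subst n'.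
case: n t t' => [|n] t t'; last first.
  exact: subtree_type_unique (typed_subtree t) (typed_subtree t').
by inversion t; inversion t'.
Qed.

Definition rk x := (sval (cid (typed_total x))).1.
Definition lab x := (sval (cid (typed_total x))).2.

Lemma typed_rk_lab x : typed (rk x) (lab x) x.
Proof. exact: (svalP (cid (typed_total x))). Qed.

Lemma typedE n N x : typed n N x -> rk x = n /\ lab x = N.
Proof. exact: typed_unique (typed_rk_lab x). Qed.

Lemma rk_root : rk r = m.+1. Proof. by case: (typedE TypedRoot). Qed.
Lemma lab_root : lab r = omega. Proof. by case: (typedE TypedRoot). Qed.

Lemma rk_child x y : child x y -> rk x = (rk y).+1.
Proof.
move=> xy; case: (typed_parent (typed_rk_lab y)) => [[_ yr]|[x' [N [xy' tx]]]].
  by rewrite yr in xy; case: (child_root xy).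
by rewrite (parent_unique tree xy xy'); case: (typedE tx).
Qed.

Lemma rk_le x : rk x <= m.+1.
Proof.
elim/(tree_ind tree): x => y IH; have [->|ry] := root_r y.
  by rewrite rk_root.
have [x xy _] := parent_between tree ry.
by have := IH _ xy.1; rewrite (rk_child xy); apply: ltnW.
Qed.

Lemma leaf_lab x : rk x = 0 -> lab x = omega.
Proof.
by have t := typed_rk_lab x; move=> x0; rewrite x0 in t; inversion t.
Qed.

Lemma lab_child n N x y : rk x = n.+2 -> child x y ->
  lab y = N <-> subtree_type prec n.+1 N y.
Proof.
move=> xn xy; have yn : rk y = n.+1 by have := rk_child xy; rewrite xn => -[].
have ty := typed_rk_lab y; rewrite yn in ty; split=> [<-|sy].
  exact: typed_subtree ty.
exact: subtree_type_unique (typed_subtree ty) sy.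
Qed.

(** The uniform description of the labels: for index 1 every child counts, by
the convention that gives label omega to index 0. *)
Lemma lab_card x : 0 < rk x ->
  has_card [set y | child x y /\ lab y = omega] (lab x).
Proof.
have tx := typed_rk_lab x; case xn: (rk x) => [//|n] _; rewrite xn in tx.
have := typed_subtree tx; case: n xn tx => [|n] xn tx /= [_ c].
  have -> : [set y | child x y /\ lab y = omega] = [set y | child x y] => //.
  apply/predeqP => y; split=> [[]//|xy]; split=> //; apply: leaf_lab.
  by have := rk_child xy; rewrite xn => -[].
move=> _ _.
suff -> : [set y | child x y /\ lab y = omega] =
    [set y | child x y /\ subtree_type prec n.+1 omega y] by [].
by apply/predeqP => y; split=> -[xy /(lab_child _ xn xy)].
Qed.

Lemma lab_at_least x k : 0 < rk x ->
  at_least [set y | child x y /\ lab y = omega] k <-> at_most k (lab x).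
Proof. by move=> x0; apply: at_least_card; apply: lab_card. Qed.

Lemma fresh_finite_child x k (s : seq T) : 1 < rk x ->
  exists y, [/\ y \notin s, child x y & lab y = Some k].
Proof.
have tx := typed_rk_lab x; case xn: (rk x) => [|[|n]] // _; rewrite xn in tx.
have [_ _ /(_ k) c _] := typed_subtree tx.
have /(at_least_card (size s).+1) [_ /(_ isT)] := c.
move=> /at_least_avoid/(_ (leqnn _))[y ys [xy /(lab_child _ xn xy) ky]].
by exists y.
Qed.


(** * Finite partial isomorphisms *)

Definition swap (p : T * T) : T * T := (p.2, p.1).

(** Finite partial isomorphisms are lists of pairs.  Closing them under parents,
on both sides at once, makes them respect the levels ([iso_rk]) and the order
([iso_prec]). *)
Definition iso (s : seq (T * T)) : Prop :=
  [/\ (r, r) \in s,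
      forall p, p \in s ->
        p = (r, r) \/ exists2 q, q \in s & child q.1 p.1 /\ child q.2 p.2
    & forall p q, p \in s -> q \in s -> (p.1 = q.1 <-> p.2 = q.2)].

Lemma swapK : involutive swap. Proof. by case. Qed.

Lemma mem_swap s p : (p \in map swap s) = (swap p \in s).
Proof. by rewrite -{1}(swapK p) (mem_map (inv_inj swapK)). Qed.

Lemma iso_swap s : iso s -> iso (map swap s).
Proof.
case=> rs par inj; split; first by rewrite mem_swap.
  move=> p; rewrite mem_swap => /par[pr|[q qs [q1 q2]]].
    by left; rewrite -(swapK p) pr.
  by right; exists (swap q); rewrite ?mem_swap ?swapK.
by move=> p q; rewrite !mem_swap => ps qs; apply: iff_sym; apply: inj ps qs.
Qed.

(** Both components of a pair descend from the root through the same chain of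
parent pairs. *)
Lemma iso_ind s (P : T * T -> Prop) : iso s -> P (r, r) ->
  (forall p q, q \in s -> p \in s -> child q.1 p.1 -> child q.2 p.2 ->
    P q -> P p) -> forall p, p \in s -> P p.
Proof.
case=> _ par _ Pr step [x y]; elim/(tree_ind tree): x y => x IH y xs.
case: (par _ xs) => [->//|[q qs [q1 q2]]].
apply: (step _ q qs xs q1 q2).
by case: q qs q1 q2 => q1 q2 /= qs qx _; apply: IH qx.1 _ qs.
Qed.

Lemma iso_rk s p : iso s -> p \in s -> rk p.1 = rk p.2.
Proof.
move=> iso_s; move: p; apply: (iso_ind iso_s) => // p q _ _ q1 q2.
by rewrite (rk_child q1) (rk_child q2) => -[].
Qed.

Lemma root_min x : ~ prec x r.
Proof. by move=> /(parent_between tree)[y /child_root]. Qed.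

Lemma iso_prec s p q : iso s -> p \in s -> q \in s ->
  prec p.1 q.1 <-> prec p.2 q.2.
Proof.
move=> iso_s ps; move: q; apply: (iso_ind iso_s) => [|q q' q's qs c1 c2 IH].
  by split=> /root_min.
rewrite (prec_child tree p.1 c1) (prec_child tree p.2 c2) IH.
by case: iso_s => _ _ /(_ p q' ps q's) ->.
Qed.

Lemma iso_child s p q : iso s -> p \in s -> q \in s ->
  child q.2 p.2 -> child q.1 p.1.
Proof.
move=> [_ par inj] ps qs qp; case: (par _ ps) => [pr|[q' q's [c1 c2]]].
  by rewrite pr in qp; case: (child_root qp).
by rewrite ((inj q q' qs q's).2 (parent_unique tree qp c2)).
Qed.

(** A new pair of nodes may be put above any old pair, as long as both nodes
are fresh. *)
Lemma iso_cons s q u v : iso s -> q \in s -> child q.1 u -> child q.2 v ->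
  u \notin map fst s -> v \notin map snd s -> iso ((u, v) :: s).
Proof.
move=> [rs par inj] qs qu qv us vs; split; first by rewrite inE rs orbT.
  move=> p; rewrite inE => /predU1P[->|/par[|[q' q's c]]].
  - by right; exists q; rewrite // inE qs orbT.
  - by left.
  - by right; exists q'; rewrite // inE q's orbT.
have new p : p \in s -> u <> p.1 /\ v <> p.2.
  by move=> ps; split=> E; [move: us | move: vs]; rewrite E map_f.
move=> p p'; rewrite !inE => /predU1P[->|ps] /predU1P[->|ps'] //=.
- by have [] := new _ ps'.
- by have [nu nv] := new _ ps; split=> E; [case: nu|case: nv].
- exact: inj.
Qed.

(** * The back-and-forth game *)

Definition le_lab (N N' : nat_or_omega) : Prop :=
  forall k, at_most k N -> at_most k N'.

(** The relation, on labels, between the first and the second components that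
lets truth of Pi_a formulas pass from the former to the latter.  At index [n],
the labels are invisible to Pi_a as long as [a <= 2n - 2]; for [a = 2n - 1] it
suffices that the second label is at most the first, as Sigma_(2n-1) formulas,
which pass the other way, can bound labels from below only; for [a >= 2n] the
labels have to agree. *)
Definition close (a : nat) (s : seq (T * T)) : Prop :=
  forall p, p \in s ->
    [\/ a + 2 <= 2 * rk p.1,
        a + 1 = 2 * rk p.1 /\ le_lab (lab p.2) (lab p.1)
      | lab p.1 = lab p.2].

(** The label [lab p.2] is the supply from which challenges at [p.1] are
answered.  It must not run short before the list has reached size [B], so that
[B] can stand for omega in a round that ends with at most [B] pairs. *)
Definition roomy (a B : nat) (s : seq (T * T)) : Prop :=
  forall p, p \in s -> 2 * rk p.1 <= a + 2 ->
  forall k, k <= B -> at_most k (lab p.1) -> at_most k (lab p.2).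

(** The start of a round: the players change sides and one quantifier is
used up. *)
Lemma close_swap a B s : iso s -> close a.+1 s ->
  close a (map swap s) /\ roomy a B (map swap s).
Proof.
move=> iso_s cl; split=> p; rewrite mem_swap => ps;
  have := cl _ ps; have /= := iso_rk iso_s ps => E; rewrite /= -E.
- by case=> [H|[H _]|->]; [apply: Or31; lia|apply: Or31; lia|apply: Or33].
- case=> [H|[H L]|->] // H' k _; [lia|exact: L].
Qed.

(** The answer [u] to a new child [v] of [q.1].  A finite label is copied: there
are infinitely many children with that label.  A node labelled omega is answered
by one labelled [B] if the level [a] cannot tell, that is, if [a <= 2n - 3]
where [n] is the index of [q.1].  If it can tell, then [u] has to be labelled
omega, and by [roomy] some such child of [q.2] is unused: since [a >= 2n - 2],
the pairs of children of [q] have equal labels so far, so as many omega-labelled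
children are used on the right as on the left, where [v] is one more. *)
Lemma respond a B s q v : iso s -> close a s -> roomy a B s -> size s < B ->
  q \in s -> child q.1 v -> v \notin map fst s ->
  exists u, [/\ iso ((v, u) :: s), close a ((v, u) :: s),
    roomy a B ((v, u) :: s) &
    lab v = omega -> a + 3 <= 2 * rk q.1 -> lab u = Some B].
Proof.
move=> iso_s cl ro sB qs qv vs.
have q12 := iso_rk iso_s qs; have q1E := rk_child qv.
have notin u : u \notin map snd s -> child q.2 u -> lab v = lab u \/
    [/\ lab v = omega, lab u = Some B & a + 3 <= 2 * rk q.1] ->
    [/\ iso ((v, u) :: s), close a ((v, u) :: s) & roomy a B ((v, u) :: s)].
  move=> us qu labs; split.
  - exact: iso_cons qs qv qu vs us.
  - move=> p; rewrite inE => /predU1P[-> /=|/cl//].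
    case: labs => [->|[-> -> aq]]; first exact: Or33.
    have [L|L] := leqP (a + 2) (2 * rk v); first exact: Or31.
    by apply: Or32; split; [lia|].
  - move=> p; rewrite inE => /predU1P[-> /=|/ro//] _ k.
    by case: labs => [->|[-> -> _]].
case vN: (lab v) => [j|].
  have q2 : 1 < rk q.2.
    rewrite -q12 q1E ltnS lt0n; apply/eqP => /leaf_lab; by rewrite vN.
  have [u [us qu uj]] := fresh_finite_child j (map snd s) q2.
  exists u; have [|? ? ?] := notin u us qu; first by left; rewrite vN uj.
  by split.
have [aq|aq] := leqP (a + 3) (2 * rk q.1).
  have q2 : 1 < rk q.2 by lia.
  have [u [us qu uj]] := fresh_finite_child B (map snd s) q2.
  exists u; have [|? ? ?] := notin u us qu; first by right.
  by split.
(* The pairs over the omega-labelled children of [q.1] used so far; the new node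
   [v] shows that [q.1] has one more such child than there are pairs in [H]. *)
pose H := [seq p <- undup s | `[< child q.1 p.1 /\ lab p.1 = omega >]].
have Hs p : p \in H -> [/\ p \in s, child q.1 p.1 & lab p.1 = omega].
  by rewrite mem_filter mem_undup => /andP[/asboolP[]].
have HB : (size H).+1 <= B.
  apply: leq_trans sB; rewrite ltnS; apply: leq_trans (size_undup s).
  by rewrite size_filter count_size.
have q0 : 0 < rk q.1 by rewrite q1E.
have: at_least [set y | child q.1 y /\ lab y = omega] (size H).+1.
  exists (v :: map fst H); split.
  - rewrite /= map_inj_in_uniq ?filter_uniq ?undup_uniq // ?andbT.
      apply/negP => /mapP[p /Hs[ps _ _] E]; move: vs; rewrite E.
      by rewrite map_f.
    move=> p p' /Hs[ps _ _] /Hs[ps' _ _] E.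
    case: iso_s => _ _ /(_ p p' ps ps')[/(_ E) E' _].
    by case: p p' E E' {ps ps'} => ? ? [? ?] /= -> ->.
  - by rewrite /= size_map.
  - move=> x; rewrite inE => /predU1P[->|/mapP[p /Hs[_ ? ?] ->]]; by split.
move=> /(lab_at_least _ q0) /(ro _ qs _ _ HB) => /(_ ltac:(lia)).
have q20 : 0 < rk q.2 by rewrite -q12.
move=> /(lab_at_least _ q20) al.
have [|u uH [qu uw]] := at_least_avoid (s := map snd H) al.
  by rewrite size_map.
have us : u \notin map snd s.
  apply: contra uH => /mapP[p ps uE]; apply/mapP; exists p => //.
  have c1 : child q.1 p.1 by apply: iso_child iso_s ps qs _; rewrite -uE.
  have := rk_child c1 => q1p; rewrite mem_filter mem_undup ps andbT.
  apply/asboolP; split=> //; case: (cl _ ps) => [|[]|->]; [lia|lia|].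
  by rewrite -uE.
exists u; have [|? ? ?] := notin u us qu; first by left; rewrite uw vN.
by split=> // _; lia.
Qed.

(** The list stays closed under parents, so the predecessors of [v] have to be
answered too, starting with the lowest one that is new.  There are at most
[m.+1 - rk v] new nodes, [v] included. *)
Lemma respond_below a B s v : iso s -> close a s -> roomy a B s ->
  size s + (m.+1 - rk v) <= B ->
  exists s' : seq (T * T), [/\ {subset s <= s'}, iso s', close a s',
    roomy a B s' &
    v \in map fst s' /\ size s' <= size s + (m.+1 - rk v)].
Proof.
elim/(tree_ind tree): v => v IH iso_s cl ro sB.
have [vs|vs] := boolP (v \in map fst s).
  by exists s; split=> //; split=> //; apply: leq_addr.
have [vr|rv] := root_r v.
  by case: iso_s vs => rs _ _; rewrite vr => /negP[]; apply/mapP; exists (r, r).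
have [x xv _] := parent_between tree rv.
have xE := rk_child xv; have xm := rk_le x.
have [|s1 [ss1 iso1 cl1 ro1 [xs1 s1B]]] := IH x xv.1 iso_s cl ro; first lia.
have [vs1|vs1] := boolP (v \in map fst s1).
  by exists s1; split=> //; split=> //; lia.
move/mapP: xs1 => [q qs1 xq]; rewrite xq in xv.
have [|u [iso2 cl2 ro2 _]] := respond iso1 cl1 ro1 _ qs1 xv vs1; first lia.
exists ((v, u) :: s1); split=> //.
  by move=> p /ss1 ps; rewrite inE ps orbT.
by rewrite /= inE eqxx; split=> //; lia.
Qed.

Lemma respond_seq a B s (w : seq T) : iso s -> close a s -> roomy a B s ->
  size s + m.+1 * size w <= B ->
  exists s' : seq (T * T), [/\ {subset s <= s'}, iso s', close a s' &
    {subset w <= map fst s'}].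
Proof.
elim: w s => [|v w IH] s iso_s cl ro sB.
  by exists s; split.
rewrite /= mulnS in sB.
have [|s1 [ss1 iso1 cl1 ro1 [vs1 s1B]]] := respond_below (v := v) iso_s cl ro.
  lia.
have [|s2 [ss2 iso2 cl2 ws2]] := IH s1 iso1 cl1 ro1; first lia.
exists s2; split=> //; first by move=> p /ss1/ss2.
move=> x; rewrite inE => /predU1P[->|/ws2//].
by case/mapP: vs1 => p /ss2 ps ->; rewrite map_f.
Qed.

Lemma back_and_forth a s (w : seq T) : iso s -> close a.+1 s ->
  exists s' : seq (T * T), [/\ {subset map swap s <= s'}, iso s', close a s' &
    {subset w <= map fst s'}].
Proof.
move=> iso_s cl; have [] := close_swap (size s + m.+1 * size w) iso_s cl.
move=> cl' ro; apply: respond_seq (iso_swap iso_s) cl' ro _.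
by rewrite size_map.
Qed.

(** * Transfer of infinitary formulas *)

Section Formulas.
Variables (k : nat) (c : k.-tuple T).

Definition matched (s : seq (T * T)) n (x y : n.-tuple T) : Prop :=
  forall i, (tnth x i, tnth y i) \in s.

Lemma matched_swap s s' n (x y : n.-tuple T) :
  {subset map swap s <= s'} -> matched s x y -> matched s' y x.
Proof. by move=> ss xy i; apply: ss; rewrite mem_swap; apply: xy. Qed.

Lemma matched_cat s n l (x y : n.-tuple T) (w z : l.-tuple T) :
  matched s x y -> matched s w z -> matched s (cat_tuple x w) (cat_tuple y z).
Proof.
move=> xy wz i; case: (split_ordP i) => j ->.
  by rewrite !tnth_lshift; apply: xy.
by rewrite !tnth_rshift; apply: wz.
Qed.

Lemma matched_exists s n (w : n.-tuple T) :
  {subset w <= map fst s} -> exists z : n.-tuple T, matched s w z.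
Proof.
move=> ws; have /choice[g gP] : forall i, exists z, (tnth w i, z) \in s.
  move=> i; have /mapP[[u z] us /= ->] := ws _ (mem_tnth i w).
  by exists z.
by exists [tuple g i | i < n] => i; rewrite tnth_mktuple.
Qed.

Lemma qf_transfer s n (q : qf_formula k n) (x y : n.-tuple T) :
  iso s -> matched s c c -> matched s x y ->
  qf_sat prec c x q <-> qf_sat prec c y q.
Proof.
move=> iso_s cc xy.
have val t : (term_val c x t, term_val c y t) \in s by case: t.
elim: q => [||t u|t u|q|q IHq q'|q IHq q'] /=; try tauto.
  by case: iso_s => _ _ /(_ _ _ (val t) (val u)).
exact: (iso_prec iso_s (val t) (val u)).
Qed.

(** Induction on the number of rounds: the universal quantifier of a Pi formula
about [y] is challenged on the side of [y] and answered on the side of [x], and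
the matrix is then transferred in the opposite direction. *)
Lemma transfer a s : iso s -> close a s -> matched s c c ->
  forall b n (x y : n.-tuple T), b <= a -> matched s x y ->
  (forall phi : Pi_in k b n, Pi_sat prec c phi x -> Pi_sat prec c phi y) /\
  (forall phi : Sigma_in k b n,
     Sigma_sat prec c phi y -> Sigma_sat prec c phi x).
Proof.
elim: a s => [|a IH] s iso_s cl cc b n x y ba xy.
  split=> phi; case: phi x y ba xy
    => [n' q x y _ xy|b' n' J e l b0 el psi x y b0']; [|lia| |lia].
    by move/(qf_transfer q iso_s cc xy).
  by move/(qf_transfer q iso_s cc xy).
have next l (w : l.-tuple T) : exists s' z,
    [/\ iso s', close a s', matched s' c c, matched s' y x & matched s' w z].
  have [s' [ss' iso' cl' ws']] := back_and_forth w iso_s cl.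
  have [z wz] := matched_exists ws'.
  by exists s', z; split=> //; apply: matched_swap ss' _.
split=> phi; case: phi x y ba xy next
  => [n' q x y _ xy _|b' n' J e l b0 el psi x y ba xy next /=].
- by move/(qf_transfer q iso_s cc xy).
- move=> H i w; have [s' [z [iso' cl' cc' yx wz]]] := next _ w.
  have ei : e i <= a by have := el i; lia.
  exact: (IH _ iso' cl' cc' _ _ _ _ ei (matched_cat yx wz)).2 (H i z).
- by move/(qf_transfer q iso_s cc xy).
- move=> [i [w H]]; have [s' [z [iso' cl' cc' yx wz]]] := next _ w.
  have ei : e i <= a by have := el i; lia.
  by exists i, z; apply: (IH _ iso' cl' cc' _ _ _ _ ei (matched_cat yx wz)).1 H.
Qed.

(** The witness [w] depends on [x] alone, so its length is known before [y] is
chosen: the label of the node that replaces [x] has to exceed that length. *)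
Lemma Sigma_witness b n (phi : Sigma_in k b n) (x : n.-tuple T) :
  Sigma_sat prec c phi x -> exists l (w : l.-tuple T), forall a s y z,
  b <= a.+1 -> iso s -> close a s -> matched s c c ->
  matched s x y -> matched s w z -> Sigma_sat prec c phi y.
Proof.
case: phi x => [n' q x qx|b' n' J e l b0 el psi x /= [i [w H]]].
  exists 0, [tuple] => a s y z _ iso_s _ cc xy _.
  exact/(qf_transfer q iso_s cc xy).
exists (l i), w => a s y z ba iso_s cl cc xy wz; exists i, z.
have ei : e i <= a by have := el i; lia.
exact: (transfer iso_s cl cc ei (matched_cat xy wz)).1 H.
Qed.

Lemma parent_closed_seq (w : seq T) : exists s : seq T,
  [/\ r \in s, {subset w <= s} &
      forall x, x \in s -> x = r \/ exists2 y, y \in s & child y x].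
Proof.
elim: w => [|v w [s [rs ws par]]].
  by exists [:: r]; split=> [|//|x]; rewrite inE // => /eqP; left.
suff [s' [ss' vs' par']] : exists s' : seq T, [/\ {subset s <= s'}, v \in s' &
    forall x, x \in s' -> x = r \/ exists2 y, y \in s' & child y x].
  exists s'; split=> //; first exact: ss'.
  by move=> x; rewrite inE => /predU1P[->|/ws/ss'].
elim/(tree_ind tree): v => v IH; have [vr|rv] := root_r v.
  by exists s; split=> //; rewrite vr.
have [x xv _] := parent_between tree rv.
have [s' [ss' xs' par']] := IH x xv.1.
exists (v :: s'); split=> [y /ss'|| y]; rewrite inE ?eqxx //;
  first by move=> ->; rewrite orbT.
case/predU1P=> [->|/par'[->|[z zs' zy]]]; [right|by left|right].
  by exists x; rewrite // inE xs' orbT.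
by exists z; rewrite // inE zs' orbT.
Qed.

Lemma iso_diagonal (s : seq T) : r \in s ->
  (forall x, x \in s -> x = r \/ exists2 y, y \in s & child y x) ->
  iso [seq (x, x) | x <- s].
Proof.
move=> rs par; split; first by apply/mapP; exists r.
  move=> _ /mapP[x xs ->]; case: (par _ xs) => [->|[y ys yx]]; first by left.
  by right; exists (y, y) => //; apply/mapP; exists y.
by move=> _ _ /mapP[x _ ->] /mapP[y _ ->].
Qed.

Lemma child_fun (f : T -> T) : bijective f ->
  (forall x y, prec x y <-> prec (f x) (f y)) ->
  forall x y, child x y <-> child (f x) (f y).
Proof.
move=> [g fK gK] fprec x y; rewrite /immediate_succ -fprec.
split=> -[xy no]; split=> // -[z [xz zy]]; apply: no.
  by exists (g z); split; apply/(fprec _ _).2; rewrite gK.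
by exists (f z); split; apply/(fprec _ _).1.
Qed.

Lemma automorphism_rk f x : automorphism prec c f -> rk (f x) = rk x.
Proof.
case=> bij fprec _; have fc := child_fun bij fprec.
elim/(tree_ind tree): x => x IH; have [->|rx] := root_r x.
  have [//|rfr] := root_r (f r); first by move=> ->.
  case: bij => g fK gK; by move: rfr; rewrite -{1}(gK r) -fprec => /root_min.
have [y yx _] := parent_between tree rx.
by have := IH y yx.1; rewrite (rk_child yx) (rk_child ((fc _ _).1 yx)) => -[].
Qed.

Lemma automorphism_inv f : automorphism prec c f ->
  exists2 g, automorphism prec c g & cancel f g.
Proof.
case=> -[g fK gK] fprec fc; exists g => //; split.
- by exists f.
- by move=> x y; rewrite (fprec (g x)) !gK.
- by apply/eq_from_tnth => i; rewrite -{1}fc !tnth_map fK.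
Qed.

(** The label of [x] counts the omega-labelled children of [x], so invariance
goes by induction on the index. *)
Lemma automorphism_lab f x : automorphism prec c f -> lab (f x) = lab x.
Proof.
have [n] := ubnP (rk x); elim: n x f => // n IH x f xn fA.
case x0: (rk x) => [|h].
  by rewrite !leaf_lab // automorphism_rk.
have mono u g : automorphism prec c g -> rk u = h.+1 ->
    forall j, at_most j (lab u) -> at_most j (lab (g u)).
  move=> gA uh j; rewrite -!lab_at_least ?automorphism_rk ?uh //.
  case=> w [uw <- wP]; exists (map g w); case: (gA) => gbij gprec gc; split.
  - by rewrite map_inj_uniq //; apply: bij_inj.
  - by rewrite size_map.
  - move=> _ /mapP[y /wP[uy yw] ->]; split; first by rewrite -(child_fun gbij).
    by rewrite IH //; have := rk_child uy; lia.
have [g gA fK] := automorphism_inv fA.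
apply: at_most_inj => j; split; last exact: mono.
by move=> /(mono _ g gA); rewrite fK; apply; rewrite automorphism_rk.
Qed.

(** The constants and their predecessors are paired with themselves, which is
close at every level; the game is then played from there, with [x] answered by
[u] as its first pair. *)
Lemma not_Sigma_definable b : 0 < m -> b <= 2 * m ->
  ~ orbits_Sigma_definable prec c b.
Proof.
move=> m0 bm def.
have [s0 [rs0 cs0 par0]] := parent_closed_seq c.
pose s := [seq (x, x) | x <- s0].
have iso_s : iso s := iso_diagonal rs0 par0.
have cc : matched s c c by move=> i; apply/map_f/cs0/mem_tnth.
have rk_r := rk_root; have lab_r := lab_root.
have [x xs [rx xw]] : exists2 x, x \notin s0 & child r x /\ lab x = omega.
  have /(lab_at_least (size s0).+1) [_] : 0 < rk r by rewrite rk_r.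
  by rewrite lab_r => /(_ isT)/at_least_avoid; apply.
have [phi phiE] := def 1 [tuple x].
have phi_x : Sigma_sat prec c phi [tuple x].
  suff: orbit_of prec c [tuple x] [tuple x] by rewrite -phiE.
  exists id; last by apply/eq_from_tnth => i; rewrite tnth_map.
  split; first by exists id.
    by [].
  by apply/eq_from_tnth => i; rewrite tnth_map.
suff [u phi_u uN] : exists2 u, Sigma_sat prec c phi [tuple u] & lab u <> omega.
  have : orbit_of prec c [tuple x] [tuple u] by rewrite -phiE.
  case=> f fA /(congr1 (fun t => tnth t ord0));
    rewrite tnth_map !(tnth_nth x) /=.
  by move=> uE; apply: uN; rewrite uE automorphism_lab.
have cl a B : close a s /\ roomy a B s.
  by split=> _ /mapP[z _ ->] //; apply: Or33.
have xs' : x \notin map fst s by rewrite -map_comp map_id.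
have rrs : (r, r) \in s by apply: map_f.
have [l [w wP]] := Sigma_witness phi_x.
(* Room for the pair of [x] and for the entries of [w], each with the at most
   [m] predecessors that it has besides the root. *)
pose B := (size s).+1 + m.+1 * l.
(* The level [2m-1] is the largest one at which a child of the root, whose
   index is [m], may trade its label omega for a smaller one. *)
have [cla ro] := cl (2 * m).-1 B.
have sB : size s < B by rewrite /B; lia.
have [u [iu cu ru lu]] := respond iso_s cla ro sB rrs rx xs'.
have uB : lab u = Some B by apply: lu => //=; rewrite rk_r; lia.
have [|s' [ss' iso' cl' ws']] := respond_seq (w := w) iu cu ru.
  by rewrite size_tuple.
have [z wz] := matched_exists ws'.
exists u; last by rewrite uB.
apply: (wP _ s' _ z) cl' _ _ wz => //; first lia.
  by move=> i; apply: ss'; rewrite inE cc orbT.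
by move=> i; rewrite ord1 !(tnth_nth x) /=; apply: ss'; rewrite inE eqxx.
Qed.
(** * Homogeneity *)

Definition lab_iso (s : seq (T * T)) : Prop :=
  iso s /\ forall p, p \in s -> lab p.1 = lab p.2.

(** All indices are at most [m+1], so [close a] forces equal labels as soon as
[a >= 2m+2], and one round of the game extends isomorphisms that respect
labels. *)
Lemma lab_iso_extend s v : lab_iso s -> exists s' : seq (T * T),
  [/\ {subset s <= s'}, lab_iso s', v \in map fst s' & v \in map snd s'].
Proof.
have back t : lab_iso t -> exists t' : seq (T * T),
    [/\ {subset map swap t <= t'}, lab_iso t' & v \in map fst t'].
  move=> [iso_t labt]; have cl : close (2 * m + 3).+1 t.
    by move=> p /labt; apply: Or33.
  have [t' [tt' iso' cl' vt']] := back_and_forth [:: v] iso_t cl.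
  exists t'; split=> //; last by apply: vt'; rewrite inE.
  by split=> // p pt; have := rk_le p.1; case: (cl' _ pt) => [|[]|//]; lia.
move=> /back[s1 [ss1 /back[s2 [ss2 iso2 vs2]] /mapP[p ps1 vp]]].
exists s2; split=> //.
  by move=> q qs; apply: ss2; rewrite mem_swap; apply: ss1;
    rewrite mem_swap swapK.
by rewrite vp; apply: (map_f snd (x := swap p)); apply: ss2;
  rewrite mem_swap swapK.
Qed.

(** Back and forth along an enumeration [dec] of the tree: each node is put in
the domain and in the range at some stage. *)
Lemma lab_iso_automorphism s : lab_iso s -> matched s c c ->
  exists2 f, automorphism prec c f & forall p, p \in s -> f p.1 = p.2.
Proof.
move=> iso_s cc.
have /countable_injP[code code_inj] := tree_countable tree.
have /choice[dec decP] : forall n, exists v : T,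
    (exists u, code u = n) -> code v = n.
  move=> n; have [[u un]|no] := pselect (exists u, code u = n).
    by exists u.
  by exists r.
have {}decP v : dec (code v) = v.
  by apply: code_inj; rewrite ?inE //; apply: decP; exists v.
have /choice[next nextP] : forall sv : seq (T * T) * T,
    exists s' : seq (T * T), lab_iso sv.1 -> [/\ {subset sv.1 <= s'},
      lab_iso s',
      sv.2 \in map fst s' & sv.2 \in map snd s'].
  move=> [t v] /=; have [/(lab_iso_extend v)[s' ?]|no] := pselect (lab_iso t).
    by exists s'.
  by exists t.
pose S := fix S n := if n is n'.+1 then next (S n', dec n') else s.
have Sn n : lab_iso (S n) by elim: n => //= n /(nextP (S n, dec n))[].
have SS n n' : n <= n' -> {subset S n <= S n'}.
  elim: n' => [|n' IH]; first by rewrite leqn0 => /eqP->.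
  rewrite leq_eqVlt ltnS => /predU1P[->//|/IH sub p /sub].
  by have [sub' _ _ _] := nextP (S n', dec n') (Sn n'); apply: sub'.
have inj n n' p q : p \in S n -> q \in S n' ->
    (p.1 = q.1 <-> p.2 = q.2) /\ (prec p.1 q.1 <-> prec p.2 q.2).
  move=> /(SS _ (maxn n n') (leq_maxl _ _)) pS.
  move=> /(SS _ (maxn n n') (leq_maxr _ _)) qS.
  have [isoS _] := Sn (maxn n n'); split; last exact: (iso_prec isoS pS qS).
  by case: isoS => _ _; apply.
have /choice[f fP] : forall x, exists y, exists n, (x, y) \in S n.
  move=> x; have [_ _ + _] := nextP (S (code x), dec (code x)) (Sn _).
  by rewrite decP => /mapP[[u y] uS /= ->]; exists y, (code x).+1;
    rewrite /= decP.
have /choice[g gP] : forall y, exists x, exists n, (x, y) \in S n.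
  move=> y; have [_ _ _] := nextP (S (code y), dec (code y)) (Sn _).
  by rewrite decP => /mapP[[x u] uS /= ->]; exists x, (code y).+1;
    rewrite /= decP.
have fE n p : p \in S n -> f p.1 = p.2.
  by move=> pS; have [n' fS] := fP p.1; have [[H _] _] := inj _ _ _ _ fS pS;
    apply: H.
exists f; last by move=> p ps; apply: (fE 0).
split.
- exists g => x; last by have [n gS] := gP x; apply: fE gS.
  have [n xS] := fP x; have [n' gS] := gP (f x).
  by have [[_ H] _] := inj _ _ _ _ gS xS; apply: H.
- move=> x y; have [n xS] := fP x; have [n' yS] := fP y.
  by have [_ H] := inj _ _ _ _ xS yS.
- by apply/eq_from_tnth => i; rewrite tnth_map; apply: (fE 0 _ (cc i)).
Qed.

(** * Defining labels and orbits *)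

(** For index 1 the order itself will do for the parent relation, which is
Pi_1: this saves the quantifier that the case [n = 1] of the Sigma_(2n-1)
definition of [has_many] cannot afford. *)
Definition below (h : nat) (x y : T) : Prop :=
  if h is 0 then prec x y else child x y.

(** The parent of the counted nodes has index [h.+1]. *)
Definition has_many (h : nat) (O : T -> Prop) (j : nat) (x : T) : Prop :=
  exists y : j.-tuple T, (forall p : 'I_j * 'I_j,
    p.1 <> p.2 -> tnth y p.1 <> tnth y p.2) /\
    forall i, below h x (tnth y i) /\ O (tnth y i).

Fixpoint omega_labelled (h : nat) (x : T) : Prop :=
  if h is h'.+1 then forall j, has_many h' (omega_labelled h') j x else True.

(** The formula for [lab x = N] at a node [x] known to have index [h]; for
finite [N] it makes sense for [0 < h] only. *)
Definition labelled (h : nat) (N : nat_or_omega) (x : T) : Prop :=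
  if N is Some j then has_many h.-1 (omega_labelled h.-1) j x /\
    ~ has_many h.-1 (omega_labelled h.-1) j.+1 x
  else omega_labelled h x.

Lemma below_child h x y : rk x = h.+1 -> below h x y <-> child x y.
Proof.
case: h => [|h] //= x1; split=> [xy|[]//].
have [z xz [<-//|zy]] := child_between tree xy.
have [w zw _] := child_between tree zy.
by have := rk_child zw; have := rk_child xz; lia.
Qed.

Lemma has_manyE h x : rk x = h.+1 ->
  (forall y, child x y -> (omega_labelled h y <-> lab y = omega)) ->
  forall j, has_many h (omega_labelled h) j x <-> at_most j (lab x).
Proof.
move=> xh IH j; rewrite -lab_at_least ?xh //; split=> [[y [yu xy]]|].
  exists (codom (tnth y)); split.
  - apply/injectiveP => i i' ii'; apply/eqP/negP => /negP/eqP ne.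
    exact: (yu (i, i')).
  - by rewrite size_codom card_ord.
  - move=> _ /codomP[i ->]; have [/(below_child _ xh) xyi o] := xy i.
    by split=> //; apply/IH.
case=> s [us sj sP]; have sz : size s == j by apply/eqP.
exists (Tuple sz); split=> [[i i'] /= ne|i].
  rewrite !(tnth_nth x) /= => /eqP; rewrite nth_uniq ?sj // => /eqP.
  by move/val_inj.
have [xy o] := sP _ (mem_tnth i (Tuple sz)).
by split; [apply/(below_child _ xh)|apply/IH].
Qed.

Lemma omega_labelledE h x : rk x = h -> omega_labelled h x <-> lab x = omega.
Proof.
elim: h x => [|h IH] x xh /=; first by rewrite leaf_lab.
have {}IH y : child x y -> (omega_labelled h y <-> lab y = omega).
  by move=> xy; apply: IH; have := rk_child xy; rewrite xh => -[].
have E := has_manyE xh IH.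
split=> [H|xw j]; last by apply/E; rewrite xw.
by apply: at_most_inj => j; split=> // _; apply/E.
Qed.

Lemma labelledE h N x : 0 < h -> rk x = h -> labelled h N x <-> lab x = N.
Proof.
case: N => [j|]; last by move=> _; apply: omega_labelledE.
case: h => // h _ xh /=.
have IH y : child x y -> (omega_labelled h y <-> lab y = omega).
  by move=> xy; apply: omega_labelledE; have := rk_child xy; rewrite xh => -[].
rewrite !(has_manyE xh IH).
case: (lab x) => [i|] /=; last by split=> // -[].
split=> [[ji ij]|[->]]; last by rewrite leqnn ltnn.
by congr Some; apply/eqP; rewrite eqn_leq ji andbT leqNgt; apply/negP.
Qed.

Lemma Pi_def_eq n (i j : 'I_n) :
  Pi_def prec c 0 (fun x : n.-tuple T => tnth x i = tnth x j).
Proof. by apply/Pi_def_qf; exists (QEq (Var k i) (Var k j)). Qed.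

Lemma Pi_def_neq n (i j : 'I_n) :
  Pi_def prec c 0 (fun x : n.-tuple T => tnth x i <> tnth x j).
Proof. by apply/Pi_def_qf; exists (QNot (QEq (Var k i) (Var k j))). Qed.

Lemma Pi_def_all_qf n (q : qf_formula k (n + 1)) : Pi_def prec c 1
  (fun x : n.-tuple T => forall z, qf_sat prec c (cat_tuple x [tuple z]) q).
Proof.
apply: (Pi_def_ext (A := fun x => forall (i : unit) (y : 1.-tuple T),
    qf_sat prec c (cat_tuple x y) q)).
  move=> x; split=> [H z|H _ y]; first exact: H tt [tuple z].
  by rewrite (_ : y = [tuple thead y]) //; apply/eq_from_tnth => i;
    rewrite ord1.
apply: (@Pi_def_forall _ _ _ _ _ _ unit (fun=> 0) (fun=> 1)
  (fun _ z => qf_sat prec c z q)) => // _.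
by exists (Sigma_qf q).
Qed.

Lemma Pi_def_child n (i j : 'I_n) :
  Pi_def prec c 1 (fun x : n.-tuple T => child (tnth x i) (tnth x j)).
Proof.
pose X := Var k (lshift 1 i); pose Y := Var k (lshift 1 j).
pose Z := Var k (rshift n (@ord0 0)).
apply: Pi_def_ext (Pi_def_all_qf (QAnd (QPrec X Y)
  (QNot (QAnd (QPrec X Z) (QPrec Z Y))))) => x.
have E z : [/\ term_val c (cat_tuple x [tuple z]) X = tnth x i,
    term_val c (cat_tuple x [tuple z]) Y = tnth x j &
    term_val c (cat_tuple x [tuple z]) Z = z].
  by rewrite /X /Y /Z /= !tnth_lshift tnth_rshift.
split=> [H|[ij no] z]; last first.
  by case: (E z) => /= -> -> ->; split=> // zz; apply: no; exists z.
split; first by have := H r; case: (E r) => /= -> -> _ [].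
by case=> z zz; have := H z; case: (E z) => /= -> -> -> [_]; apply.
Qed.

Lemma Pi_def_min n (i : 'I_n) :
  Pi_def prec c 1 (fun x : n.-tuple T => forall z, ~ prec z (tnth x i)).
Proof.
apply: Pi_def_ext (Pi_def_all_qf
  (QNot (QPrec (Var k (rshift n (@ord0 0))) (Var k (lshift 1 i))))) => x.
split=> H z; move: (H z); by rewrite /= tnth_lshift tnth_rshift.
Qed.

Lemma Pi_def_below h n (i j : 'I_n) :
  Pi_def prec c (2 * h) (fun x : n.-tuple T => below h (tnth x i) (tnth x j)).
Proof.
case: h => [|h] /=; last by apply: Pi_def_le (Pi_def_child i j); lia.
by apply/Pi_def_qf; exists (QPrec (Var k i) (Var k j)).
Qed.

Lemma Sigma_def_has_many h (O : T -> Prop) j n (i : 'I_n) :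
  (forall n' (i' : 'I_n'),
     Pi_def prec c (2 * h) (fun x : n'.-tuple T => O (tnth x i'))) ->
  Sigma_def prec c (2 * h + 1) (fun x : n.-tuple T => has_many h O j (tnth x
    i)).
Proof.
move=> PO.
pose A (_ : unit) (z : (n + j).-tuple T) :=
  (forall p : 'I_j * 'I_j, p.1 <> p.2 ->
     tnth z (rshift n p.1) <> tnth z (rshift n p.2)) /\
  forall q, below h (tnth z (lshift j i)) (tnth z (rshift n q)) /\
            O (tnth z (rshift n q)).
apply: (Sigma_def_ext (A := fun x => exists u y, A u (cat_tuple x y))).
  move=> x; split=> [[_ [y [yu yO]]]|[y [yu yO]]].
    exists y; split=> [p ne|q].
      by have := yu p ne; rewrite !tnth_rshift.
    by have := yO q; rewrite !tnth_rshift tnth_lshift.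
  exists tt, y; split=> [p ne|q]; rewrite !tnth_rshift; first exact: yu.
  by rewrite tnth_lshift.
apply: (@Sigma_def_exists _ _ _ _ _ _ unit (fun=> 2 * h) (fun=> j) A) => [|_|u].
- by rewrite addn1.
- by rewrite addn1.
apply: Pi_def_and.
  apply: Pi_def_all => p; apply: Pi_def_imply => _.
  by apply: Pi_def_le (Pi_def_neq _ _).
by apply: Pi_def_all => q; apply: Pi_def_and (Pi_def_below _ _ _) (PO _ _).
Qed.

Lemma Pi_def_omega_labelled h n (i : 'I_n) :
  Pi_def prec c (2 * h) (fun x : n.-tuple T => omega_labelled h (tnth x i)).
Proof.
elim: h n i => [|h IH] n i.
  by apply/Pi_def_qf; exists (QTrue k n).
apply: (Pi_def_ext (A := fun x => forall (j : nat) (y : 0.-tuple T),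
    has_many h (omega_labelled h) j (tnth (cat_tuple x y) (lshift 0 i)))).
  move=> x; split=> [H j|H j y]; last by rewrite tnth_lshift.
  by have := H j [tuple]; rewrite tnth_lshift.
apply: (@Pi_def_forall _ _ _ _ _ _ nat (fun=> 2 * h + 1) (fun=> 0)
  (fun j z => has_many h (omega_labelled h) j (tnth z (lshift 0 i)))) => [|_|j].
- by lia.
- by lia.
exact: Sigma_def_has_many.
Qed.

Lemma Pi_def_labelled h N n (i : 'I_n) : 0 < h ->
  Pi_def prec c (2 * h) (fun x : n.-tuple T => labelled h N (tnth x i)).
Proof.
case: N => [j|] h0 /=; last exact: Pi_def_omega_labelled.
have D j' n' (i' : 'I_n') : Sigma_def prec c (2 * h.-1 + 1) (fun x =>
    has_many h.-1 (omega_labelled h.-1) j' (tnth x i')).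
  by apply: Sigma_def_has_many => *; apply: Pi_def_omega_labelled.
apply: Pi_def_and; last by apply: Pi_def_le (Sigma_def_not (D _ _ _)); lia.
apply: (Pi_def_ext (A := fun x => forall (u : unit) (y : 0.-tuple T),
    has_many h.-1 (omega_labelled h.-1) j (tnth (cat_tuple x y) (lshift 0 i)))).
  move=> x; split=> [/(_ tt [tuple])|H u y]; by rewrite tnth_lshift.
apply: (@Pi_def_forall _ _ _ _ _ _ unit (fun=> 2 * h.-1 + 1) (fun=> 0)
  (fun _ z => has_many h.-1 (omega_labelled h.-1) j (tnth z (lshift 0 i))))
  => [|_|u]; [lia|lia|exact: D].
Qed.

(** The list [s] is the closure of the tuple and the constants under parents,
and [copy] describes it, up to isomorphism with labels.  The label of the root
is left out, as the root has index [m+1] and is determined by being minimal. *)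
Lemma orbits_Sigma : 0 < m -> orbits_Sigma_definable prec c (2 * m + 1).
Proof.
move=> m0 n x.
have [s [rs ws par]] := parent_closed_seq (x ++ c).
pose p := in_tuple s; pose l := size s.
have ps v : v \in s -> exists i : 'I_l, tnth p i = v.
  by move=> vs; have /tnthP[i ->] : v \in p by []; exists i.
have /choice[ix ixP] : forall i : 'I_n, exists j, tnth p j = tnth x i.
  move=> i; apply: ps; apply: ws.
  by rewrite mem_cat mem_tnth.
have /choice[ic icP] : forall i : 'I_k, exists j, tnth p j = tnth c i.
  move=> i; apply: ps; apply: ws.
  by rewrite mem_cat mem_tnth orbT.
pose node (z : (n + l).-tuple T) i := tnth z (rshift n i).
pose copy (z : (n + l).-tuple T) :=
  (forall i, node z (ix i) = tnth z (lshift l i)) /\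
  (forall i, node z (ic i) = tnth c i) /\
  (forall ij : 'I_l * 'I_l, tnth p ij.1 = tnth p ij.2 ->
     node z ij.1 = node z ij.2) /\
  (forall ij : 'I_l * 'I_l, tnth p ij.1 <> tnth p ij.2 ->
     node z ij.1 <> node z ij.2) /\
  (forall ij : 'I_l * 'I_l, child (tnth p ij.1) (tnth p ij.2) ->
     child (node z ij.1) (node z ij.2)) /\
  (forall i, tnth p i = r -> forall t, ~ prec t (node z i)) /\
  (forall i, 0 < rk (tnth p i) <= m ->
     labelled (rk (tnth p i)) (lab (tnth p i)) (node z i)).
have copy_def : Pi_def prec c (2 * m) copy.
  have m1 : 1 <= 2 * m by lia.
  apply: Pi_def_and.
    by apply: Pi_def_all => i; apply: Pi_def_le (Pi_def_eq _ _).
  apply: Pi_def_and.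
    apply: Pi_def_all => i; apply: (@Pi_def_le _ _ _ _ 0) => //.
    by apply/Pi_def_qf; exists (QEq (Var k (rshift n (ic i))) (Const _ i)).
  apply: Pi_def_and.
    apply: Pi_def_all => ij; apply: Pi_def_imply => _.
    exact: Pi_def_le (Pi_def_eq _ _).
  apply: Pi_def_and.
    apply: Pi_def_all => ij; apply: Pi_def_imply => _.
    exact: Pi_def_le (Pi_def_neq _ _).
  apply: Pi_def_and.
    apply: Pi_def_all => ij; apply: Pi_def_imply => _.
    exact: Pi_def_le m1 (Pi_def_child _ _).
  apply: Pi_def_and.
    apply: Pi_def_all => i; apply: Pi_def_imply => _.
    exact: Pi_def_le m1 (Pi_def_min _).
  apply: Pi_def_all => i; apply: Pi_def_imply => /andP[h0 hm].
  apply: Pi_def_le (Pi_def_labelled _ _ h0); lia.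
have [|phi phiE] := @Sigma_def_exists _ prec _ c (2 * m + 1) n unit (fun=> 2 *
  m)
    (fun=> l) (fun _ => copy) ltac:(lia) ltac:(lia).
  by [].
exists phi; apply/predeqP => y /=; rewrite phiE {phi phiE copy_def}.
split=> [[_ [q [qx [qc [qeq [qneq [qch [qr qlab]]]]]]]]|].
  have nodeE i : node (cat_tuple y q) i = tnth q i by rewrite /node tnth_rshift.
  pose t := [seq (tnth p i, tnth q i) | i <- enum 'I_l].
  have tP i : (tnth p i, tnth q i) \in t by apply: map_f; rewrite mem_enum.
  have tI (P : T * T -> Prop) :
      (forall i, P (tnth p i, tnth q i)) -> forall u, u \in t -> P u.
    by move=> H _ /mapP[i _ ->].
  have root i : tnth p i = r -> tnth q i = r.
    move=> /qr; rewrite nodeE => qmin.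
    by have [//|/qmin] := root_r (tnth q i).
  have iso_t : iso t.
    split.
    - have [i ir] := ps _ rs; have := tP i.
      by rewrite ir (root i ir).
    - apply: tI => i; have [/= ir|[v vs vi]] := par (tnth p i) (mem_tnth i p).
        by left; rewrite ir (root i ir).
      have [j jv] := ps _ vs; right; exists (tnth p j, tnth q j) => //=.
      rewrite jv; split=> //; rewrite -(nodeE i) -(nodeE j).
      by apply: (qch (j, i)); rewrite /= jv.
    - move=> u u' /mapP[i _ ->] /mapP[j _ ->] /=.
      rewrite -(nodeE i) -(nodeE j); split=> [|E]; first exact: qeq (i, j).
      by apply: contrapT => /(qneq (i, j)).
  have lab_t : lab_iso t.
    split=> //; apply: tI => i /=; have E := iso_rk iso_t (tP i).
    case h0: (rk (tnth p i)) => [|h].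
      by rewrite !leaf_lab // -E.
    have [hm|mh] := leqP h.+1 m.
      apply/esym/(@labelledE h.+1) => //; first by rewrite -E.
      by rewrite -(nodeE i) -h0; apply: qlab; rewrite h0.
    (* Only the root has an index above [m]. *)
    suff top v : rk v = h.+1 -> v = r.
      by rewrite (top (tnth p i) h0) (top (tnth q i)) // -E.
    move=> vh; have [//|rv] := root_r v.
    have [w wv _] := parent_between tree rv.
    by have := rk_child wv; have := rk_le w; lia.
  have tc : matched t c c.
    move=> i; have := tP (ic i).
    by rewrite icP -(nodeE (ic i)) qc.
  have [f fA ft] := lab_iso_automorphism lab_t tc.
  exists f => //; apply/eq_from_tnth => i; rewrite tnth_map -ixP.
  by rewrite (ft _ (tP (ix i))) /= -nodeE qx tnth_lshift.
case=> f fA ->; exists tt, (map_tuple f p).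
have nodeE i : node (cat_tuple (map_tuple f x) (map_tuple f p)) i = f (tnth p
  i).
  by rewrite /node tnth_rshift tnth_map.
case: (fA) => fbij fprec fc; have finj := bij_inj fbij.
split; first by move=> i; rewrite nodeE tnth_lshift tnth_map ixP.
split; first by move=> i; rewrite nodeE icP -{2}fc tnth_map.
split; first by move=> ij; rewrite !nodeE => ->.
split; first by move=> ij ne; rewrite !nodeE => /finj.
split; first by move=> ij; rewrite !nodeE => /(child_fun fbij fprec).
split.
  move=> i ir v; rewrite nodeE ir; case: fbij => g fK gK.
  by rewrite -(gK v) -fprec; apply: root_min.
move=> i /andP[h0 hm]; rewrite nodeE; apply/(labelledE _ h0).
  exact: automorphism_rk.
exact: automorphism_lab.
Qed.

End Formulas.
End TypedTree.

Theorem theorem7p5 (m : nat) (hm : 1 <= m) (T : Type) (prec : T -> T -> Prop)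
    (hT : tree_of_type prec m.+1 omega) (k : nat) (a : k.-tuple T) :
  SR_is prec a (2 * m + 1).
Proof.
have [tree [r root_r type_r]] := hT.
split; first exact: (@orbits_Sigma {classic T} prec m r tree root_r type_r k a
  hm).
move=> b; rewrite addn1 ltnS => bm.
exact: (@not_Sigma_definable {classic T} prec m r tree root_r type_r k a b hm
  bm).
Qed.
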